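(* Let $n$ and $d$ be integers with $d\geq 3$ and $n\geq 4d-2$. Then $\gamma_t(K_{n,d})=2$, where $K_{n,d}$ is the circular complete graph.
   Context: For positive integers $n,d$ with $n\geq 2d$, the circular complete graph $K_{n,d}$ is the (simple, undirected) graph with vertex set $\{v_0,v_1,\ldots,v_{n-1}\}$ in which $v_i$ is adjacent to $v_j$ if and only if $d\leq |i-j|\leq n-d$. (It is not a complete bipartite graph.) A set $S$ of vertices in a graph $G=(V,E)$ is called a total dominating set if every vertex $v\in V$ (including those in $S$) is adjacent to some element of $S$. The total domination number $\gamma_t(G)$ is the minimum cardinality of a total dominating set of $G$. *)

(* Defs.v *)
From HB Require Import structures.
From mathcomp Require Import all_boot all_order all_algebra.

Set Implicit Arguments.
Unset Strict Implicit.
Unset Printing Implicit Defensive.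

Import IntDist.

(* A graph on V is given by its adjacency relation. *)

Definition total_dominating (V : finType) (e : rel V) (S : {set V}) : bool :=
  [forall v : V, exists s in S, e v s].

(* The default setT is reached only when no total dominating set exists, that
   is, when some vertex has no neighbour; the value is then #|V| by convention,
   the parameter being undefined for such graphs. *)
Definition total_domination_number (V : finType) (e : rel V) : nat :=
  #|[arg min_(S < [set: V] | total_dominating e S) #|S| ]|.

(* The vertex v_i is represented by i : 'I_n, and `|i - j| is the distance of
   i and j as integers, not truncated subtraction. *)
Definition circular_complete (n d : nat) : rel 'I_n :=
  fun i j => d <= `|i - j| <= n - d.

Arguments circular_complete : clear implicits.

Lemma circular_complete_sym n d : symmetric (circular_complete n d).
Proof. by move=> i j; rewrite /circular_complete distnC. Qed.

Lemma circular_complete_irr n d :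
  0 < d -> irreflexive (circular_complete n d).
Proof. by move=> d_gt0 i; rewrite /circular_complete distnn leqNgt d_gt0. Qed.

(* Main.v *)
Require Import Defs.
From mathcomp Require Import all_boot all_order all_algebra.
From mathcomp Require Import zify.

(** Without loops no single vertex is adjacent to itself, so a total dominating
    set has at least two elements ([total_dominating_card_gt1]), and it remains
    to dominate with two ([circular_complete_dominating_pair]).  The
    vertices not adjacent to v_i (v_i included) form the circular interval of
    the 2d - 1 vertices at circular distance less than d from v_i.  A pair is
    total dominating exactly when its two intervals are disjoint, and disjoint
    intervals of this length fit on the circle because n >= 2 (2d - 1) = 4d - 2.
    Those around v_0 and v_(2d-1) are consecutive, hence disjoint. *)

(** A set with at most one element s cannot dominate s itself; the inhabitant
    excludes the empty graph, whose empty set is vacuously total dominating. *)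
Lemma total_dominating_card_gt1 (V : finType) (e : rel V) (S : {set V}) :
  V -> irreflexive e -> total_dominating e S -> 1 < #|S|.
Proof.
move=> v0 e_irr /forallP domS.
have /exists_inP[s sS _] := domS v0.
have /exists_inP[t tS est] := domS s.
apply/card_gt1P; exists s, t; split=> //.
by apply: contraTneq est => <-; rewrite e_irr.
Qed.

Lemma total_domination_number_pair (V : finType) (e : rel V) (x y : V) :
    irreflexive e -> (forall v, e v x || e v y) ->
  total_domination_number e = 2.
Proof.
move=> e_irr domxy.
have domS : total_dominating e [set x; y].
  apply/forallP=> v; apply/exists_inP.
  by case/orP: (domxy v) => ev; [exists x | exists y]; rewrite ?set21 ?set22.
(* The default value setT of the minimum is harmless: it contains a total
   dominating set, so it is one. *)
have domT : total_dominating e [set: V].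
  apply/forallP=> v; apply/exists_inP.
  by have /forallP/(_ v)/exists_inP[s _ evs] := domS; exists s.
rewrite /total_domination_number; case: arg_minnP => // S dS minS.
apply/eqP; rewrite eqn_leq (total_dominating_card_gt1 _ _ _ x e_irr dS) andbT.
by apply: leq_trans (minS _ domS) _; rewrite cards2; case: (x != y).
Qed.

(** The vertices that v_0 misses have index v < d or v > n - d.  In the first
    case 2d - 1 - v lies between d and 2d - 1 <= n - d; in the second
    v - (2d - 1) lies between n - 3d + 2 >= d and n - 2d, and this lower bound
    is where n >= 4d - 2 is sharp. *)
Lemma circular_complete_dominating_pair (n d : nat) (x y v : 'I_n) :
    4 * d - 2 <= n -> 0 < d -> x = 0 :> nat -> y = 2 * d - 1 :> nat ->
  circular_complete n d v x || circular_complete n d v y.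
Proof.
rewrite /circular_complete => n_ge d_gt0 -> ->.
by have := ltn_ord v; lia.
Qed.

Theorem theorem5 (n d : nat) (d_ge3 : 3 <= d) (n_ge : 4 * d - 2 <= n) :
  total_domination_number (circular_complete n d) = 2.
Proof.
have d_gt0 : 0 < d by apply: leq_trans d_ge3.
have x_lt : 0 < n by lia.
have y_lt : 2 * d - 1 < n by lia.
apply: (@total_domination_number_pair _ _ (Ordinal x_lt) (Ordinal y_lt)).
  exact: circular_complete_irr.
by move=> v; apply: circular_complete_dominating_pair.
Qed.
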